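(* For every finite simple graph $G$ with at least one vertex, $$\alpha_1(G)\geq Z_2(G)=\sum_{v\in V(G)}\min\left\{1,\frac{1}{\zeta(v)+\frac12}\right\}.$$
   Context: For an integer $k\geq 0$, a $k$-independent set of $G$ is a set $S\subseteq V(G)$ with $\Delta(G[S])\leq k$, and $\alpha_k(G)$ is the maximum cardinality of a $k$-independent set. For a vertex $v$, $\zeta(v)=\max_H\delta(H)$, the maximum over all subgraphs $H$ of $G$ containing $v$, where $\delta(H)$ is the minimum degree (isolated vertices have $\zeta=0$). *)

(* Defs.v *)
From HB Require Import structures.
From mathcomp Require Import all_boot all_order all_algebra.

Set Implicit Arguments.
Unset Strict Implicit.
Unset Printing Implicit Defensive.

Import Order.TTheory GRing.Theory Num.Theory.

Record sgraph := SGraph {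
  vertex :> finType;
  adj : rel vertex;
  adj_sym : symmetric adj;
  adj_irrefl : irreflexive adj
}.

(* The degree and its extrema are taken in the graph with vertex set S whose
   adjacency is the restriction of r to S. *)
Definition degree (T : finType) (S : {set T}) (r : rel T) (x : T) : nat :=
  #|[set y in S | r x y]|.

Definition max_degree (T : finType) (S : {set T}) (r : rel T) : nat :=
  \max_(x in S) degree S r x.

(* The default #|T| bounds every degree, so this is the true minimum whenever
   S is nonempty, which is the only case used. *)
Definition min_degree (T : finType) (S : {set T}) (r : rel T) : nat :=
  \big[minn/#|T|]_(x in S) degree S r x.

Definition k_independent (G : sgraph) (k : nat) (S : {set G}) : bool :=
  max_degree S (@adj G) <= k.

Definition alpha (G : sgraph) (k : nat) : nat :=
  \max_(S : {set G} | k_independent k S) #|S|.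

(* H consists of a vertex set and a set of ordered pairs, an edge {x, y} being
   recorded by both (x, y) and (y, x); it need not be induced. *)
Definition subgraph (G : sgraph) (H : {set G} * {set G * G}) : bool :=
  [forall x, forall y, ((x, y) \in H.2) ==>
     [&& x \in H.1, y \in H.1, adj x y & (y, x) \in H.2]].

Definition zeta (G : sgraph) (v : G) : nat :=
  \max_(H : {set G} * {set G * G} | subgraph H && (v \in H.1))
     min_degree H.1 (fun x y => (x, y) \in H.2).

Definition Z2 (G : sgraph) : rat :=
  (\sum_(v : G) Num.min 1 (1 / ((zeta v)%:R + 1 / 2%:R)))%R.

(* Main.v *)
(** Delete closed neighbourhoods greedily: it suffices to find, in every induced
    subgraph [S], vertices [x] and [y] (possibly equal) whose joint closed
    neighbourhood in [S] has weight at most [#|[set x; y]|].  Let [d] be the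
    minimum degree of [S], so that [zeta >= d] on [S].  Two distinct vertices whose
    joint closed neighbourhood has at most [2d + 1] elements do the job.  If there
    are none, the vertices of degree [d] have disjoint closed neighbourhoods
    containing no vertex of degree [d + 1], so removing them all leaves minimum
    degree at least [d + 1].  A vertex of degree [d] then costs at most
    [min(1, 1/(d + 1/2)) + d/(d + 3/2)], at most 1 unless [d = 1].  If [d = 1],
    the same dichotomy applied to the graph without its leaves yields either a
    suitable pair or a leaf whose neighbour has [zeta >= 3]; that leaf costs at
    most [2/3 + 2/7 < 1]. *)
Require Import Defs.
From mathcomp Require Import all_boot all_order all_algebra.
From mathcomp Require Import ring lra zify.
Import Order.TTheory GRing.Theory Num.Theory.
Local Open Scope ring_scope.

Set Implicit Arguments.
Unset Strict Implicit.
Unset Printing Implicit Defensive.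

(** * Weights and lower bounds on [zeta] *)

Definition weight (n : nat) : rat := Num.min 1 (1 / (n%:R + 1 / 2%:R)).

Lemma weight_le1 (n : nat) : weight n <= 1.
Proof. by rewrite /weight ge_min lexx. Qed.

Lemma weight_le (d n : nat) : (d <= n)%N -> weight n <= 2 / (2 * d + 1)%:R.
Proof.
move=> le_dn; rewrite /weight ge_min; apply/orP; right.
have -> : 1 / (n%:R + 1 / 2%:R) = 2 / (2 * n + 1)%:R :> rat.
  have n0 : 0 <= n%:R :> rat by exact: ler0n.
  rewrite natrD natrM; field; apply: lt0r_neq0; lra.
rewrite ler_pM2l // lef_pV2 ?posrE ?ltr0n ?addn1 //.
by rewrite ler_nat; lia.
Qed.

Lemma sum_weight_le (T : finType) (z : T -> nat) (d : nat) (A D : {set T}) :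
    A \subset D -> {in D, forall x, (d <= z x)%N} ->
  \sum_(x in A) weight (z x) <= #|D|%:R * (2 / (2 * d + 1)%:R).
Proof.
move=> sAD zD; apply: (@le_trans _ _ (\sum_(x in A) (2 / (2 * d + 1)%:R))).
  by apply: ler_sum => x Ax; apply/weight_le/zD/(subsetP sAD).
rewrite sumr_const -[leLHS]mulr_natl ler_wpM2r ?divr_ge0 ?ler0n //.
by rewrite ler_nat subset_leq_card.
Qed.

(** The subgraph induced on [T] is the witness: it contains [x], and its minimum degree is at least
    [d]. *)
Lemma zeta_ge (G : sgraph) (T : {set G}) (d : nat) :
    {in T, forall x, (d <= degree T (@adj G) x)%N} ->
  {in T, forall x, (d <= zeta x)%N}.
Proof.
move=> dT x Tx.
pose E := [set p : G * G | [&& p.1 \in T, p.2 \in T & adj p.1 p.2]].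
have degE y : y \in T ->
    degree T (fun a b => (a, b) \in E) y = degree T (@adj G) y.
  move=> Ty; apply: eq_card => u; rewrite !inE /= Ty.
  by case: (u \in T).
apply: leq_trans (leq_bigmax_cond (T, E) _); last first.
  rewrite Tx andbT; apply/forallP => a; apply/forallP => b; apply/implyP.
  by rewrite !inE /= (adj_sym b a) => /and3P[-> -> ->].
rewrite /min_degree /=; elim/big_ind: _ => [|a b da db|y Ty].
(* The default of the minimum is the number of all vertices, which bounds every degree. *)
- exact: leq_trans (dT x Tx) (max_card _).
- by rewrite leq_min da.
- by rewrite degE ?dT.
Qed.

Lemma k_independent_setU (G : sgraph) (k : nat) (I J : {set G}) :
    k_independent k I -> k_independent k J ->
    {in I & J, forall x y, ~~ adj x y} -> k_independent k (I :|: J).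
Proof.
move=> /bigmax_leqP hI /bigmax_leqP hJ nIJ; apply/bigmax_leqP => x.
rewrite inE => /orP[Ix | Jx].
- apply: leq_trans (hI x Ix); apply/subset_leq_card/subsetP => y.
  rewrite !inE => /andP[/orP[-> //|Jy] xy].
  by rewrite (negPf (nIJ x y Ix Jy)) in xy.
- apply: leq_trans (hJ x Jx); apply/subset_leq_card/subsetP => y.
  rewrite !inE => /andP[/orP[Iy|-> //] xy].
  by rewrite adj_sym (negPf (nIJ y x Iy Jx)) in xy.
Qed.

(** * Closed neighbourhoods inside an induced subgraph *)

Section ClosedNeighbourhood.

Variable G : sgraph.
Implicit Types (S C : {set G}) (x y : G).

Local Notation deg S x := (degree S (@adj G) x).

Definition closed_nbhd S x := [set y in S | (y == x) || adj x y].

Lemma card_closed_nbhd S x : x \in S -> #|closed_nbhd S x| = (deg S x).+1.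
Proof.
move=> Sx; rewrite (cardsD1 x) !inE Sx eqxx add1n /degree; congr _.+1.
apply: eq_card => y; rewrite !inE; case: eqVneq => [->|] //=.
by rewrite adj_irrefl andbF.
Qed.

Lemma k_independent_pair x y : k_independent 1 [set x; y].
Proof.
apply/bigmax_leqP => u Au; rewrite -ltnS -card_closed_nbhd //.
apply: (@leq_trans #|[set x; y]|); last by rewrite cards2; case: eqP.
by apply/subset_leq_card/subsetP => v; rewrite inE => /andP[].
Qed.

(** Inclusion-exclusion: each known common member, collected in [A], improves the bound by one. *)
Lemma card_joint_nbhd S x y (A : {set G}) :
    x \in S -> y \in S ->
    A \subset closed_nbhd S x :&: closed_nbhd S y ->
  (#|closed_nbhd S x :|: closed_nbhd S y| + #|A| <= deg S x + deg S y + 2)%N.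
Proof.
move=> Sx Sy /subset_leq_card leA.
have := cardsUI (closed_nbhd S x) (closed_nbhd S y).
by rewrite !card_closed_nbhd //; lia.
Qed.

(** Let [z] be outside [B], so of degree at least [d + 1]. Two neighbours of [z] in [B] would share
    [z]; a single neighbour [x] in [B] shares both [x] and [z] with [z]. The size bound excludes the
    first case and forces degree at least [d + 2] in the second, where only one neighbour is lost.
    The hypothesis is restricted to the pairs used here because, in the graph without leaves, it is
    established only for these. *)
Lemma degree_core S (d : nat) (B := [set x in S | deg S x == d]) :
    {in S, forall x, (d <= deg S x)%N} ->
    (forall x y, x \in B -> y \in S -> x != y -> (y \in B) || adj x y ->
      (2 * d + 1 < #|closed_nbhd S x :|: closed_nbhd S y|)%N) ->
  {in S :\: B, forall x, (d.+1 <= deg (S :\: B) x)%N}.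
Proof.
move=> dS far z /setDP[Sz Bz].
have BP x : x \in B -> x \in S /\ deg S x = d by rewrite inE => /andP[? /eqP].
have dz : (d < deg S z)%N.
  by rewrite ltn_neqAle dS // andbT eq_sym; move: Bz; rewrite inE Sz.
pose N := [set y in S | adj z y].
have degD : deg S z = (deg (S :\: B) z + #|N :&: B|)%N.
  rewrite /degree -/N -(cardsID B N) addnC; congr (_ + _)%N.
  by apply: eq_card => y; rewrite !inE andbA.
case: (set_0Vmem (N :&: B)) degD => [-> | [x]]; first by rewrite cards0; lia.
rewrite !inE -andbA => /and4P[Sx zx _ dx] degD.
have Bx : x \in B by rewrite inE Sx.
have zNx : z != x by apply: contraNneq Bz => ->.
have NB : N :&: B = [set x].
  apply/setP => y; rewrite [RHS]inE; apply/idP/eqP => [|->]; last first.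
    by rewrite in_setI Bx inE Sx zx.
  rewrite in_setI inE -andbA => /and3P[Sy zy By]; apply/eqP/contraT => yx.
  have xy : x != y by rewrite eq_sym.
  have := far x y Bx Sy xy; rewrite By => /(_ isT).
  have := @card_joint_nbhd S x y [set z] Sx Sy.
  rewrite sub1set !inE Sz (adj_sym x) (adj_sym y) zx zy !orbT => /(_ isT).
  by rewrite cards1 (BP x Bx).2 (BP y By).2; lia.
have := far x z Bx Sz; rewrite eq_sym zNx adj_sym zx orbT => /(_ isT isT).
have := @card_joint_nbhd S x z [set x; z] Sx Sz.
rewrite subUset !sub1set !inE Sx Sz !eqxx (adj_sym x) zx !orbT => /(_ isT).
rewrite cards2 eq_sym zNx (BP x Bx).2; move: degD; rewrite NB cards1; lia.
Qed.

End ClosedNeighbourhood.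

(** * One greedy removal *)

Section GreedyStep.

Variables (G : sgraph) (S : {set G}).

Local Notation deg A x := (degree A (@adj G) x).
Local Notation joint_nbhd x y := (closed_nbhd S x :|: closed_nbhd S y).
Local Notation cost x y := (\sum_(u in joint_nbhd x y) weight (zeta u)).

(** The vertex [x] is weighed apart, since its neighbours may have a better lower bound on
    [zeta]. *)
Lemma sum_weight_nbhd (d : nat) (x : G) :
    x \in S ->
    {in closed_nbhd S x :\ x, forall y, (d <= zeta y)%N} ->
  cost x x <= weight (zeta x) + (deg S x)%:R * (2 / (2 * d + 1)%:R).
Proof.
move=> Sx dx; have Nx : x \in closed_nbhd S x by rewrite inE Sx eqxx.
rewrite setUid (big_setD1 x) //= lerD2l.
have := cardsD1 x (closed_nbhd S x).
rewrite Nx card_closed_nbhd // add1n => -[->].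
exact: sum_weight_le.
Qed.

Lemma greedy_pair :
  S != set0 -> exists x y, [/\ x \in S, y \in S & cost x y <= #|[set x; y]|%:R].
Proof.
move=> S0.
suff : [exists x in S, exists y in S, cost x y <= #|[set x; y]|%:R].
  by move=> /exists_inP[x Sx] /exists_inP[y Sy] le_xy; exists x, y.
apply: contraT => /exists_inPn bad.
have {}bad x y : x \in S -> y \in S -> ~~ (cost x y <= #|[set x; y]|%:R).
  by move=> Sx Sy; have /exists_inPn := bad x Sx; apply.
(* At most [2 * d + 1] weights, each at most [2 / (2 * d + 1)], sum to at most 2, the size of the
   pair. *)
have far (D : {set G}) d x y : x \in S -> y \in S -> x != y ->
    joint_nbhd x y \subset D -> {in D, forall u, (d <= zeta u)%N} ->
    (2 * d + 1 < #|D|)%N.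
  move=> Sx Sy xy sD dD; rewrite ltnNge; apply/negP => leD.
  move/negP: (bad x y Sx Sy); apply; rewrite cards2 xy.
  apply: le_trans (sum_weight_le sD dD) _.
  rewrite mulrA ler_pdivrMr ?ltr0n ?addn1 // mulrC ler_pM2l //.
  by rewrite ler_nat -addn1.
have [s0 Ss0] := set0Pn _ S0.
have [v /= Sv minv] := @arg_minnP _ s0 (fun x => x \in S) (fun x => deg S x) Ss0.
have [d degv] : {d | deg S v = d} by exists (deg S v).
have dS : {in S, forall x, (d <= deg S x)%N} by rewrite -degv.
have zS := zeta_ge dS.
have subN x : closed_nbhd S x \subset S by apply/subsetP => y; rewrite inE => /andP[].
have farS x y : x \in S -> y \in S -> x != y -> (2 * d + 1 < #|joint_nbhd x y|)%N.
  move=> Sx Sy xy; apply: (far _ d x y) => // u; rewrite inE.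
  by case/orP=> /(subsetP (subN _)); apply: zS.
pose B := [set x in S | deg S x == d]; pose C := S :\: B.
have Bv : v \in B by rewrite inE Sv degv eqxx.
have BS x : x \in B -> x \in S by rewrite inE => /andP[].
have CS x : x \in C -> x \in S by rewrite inE => /andP[].
have degB x : x \in B -> deg S x = d by rewrite inE => /andP[_ /eqP].
have dC : {in C, forall x, (d.+1 <= deg C x)%N}.
  by apply: degree_core => // x y Bx Sy xy _; apply: farS => //; apply: BS.
have zC := zeta_ge dC.
(* Adjacent [x] and [y] in [B] would share two vertices, leaving at most [2 * d] in the union. *)
have nbrB x y : x \in B -> y \in S -> adj x y -> y \in C.
  move=> Bx Sy xy; rewrite inE Sy andbT; apply: contraL xy => By.
  apply/negP => xy.
  have xNy : x != y by apply: contraTneq xy => ->; rewrite adj_irrefl.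
  have Sx := BS x Bx.
  have := farS x y Sx Sy xNy.
  have := @card_joint_nbhd _ S x y [set x; y] Sx Sy.
  rewrite subUset !sub1set !inE Sx Sy !eqxx (adj_sym y) xy !orbT => /(_ isT).
  by rewrite cards2 xNy !degB //; lia.
have nbrv y : y \in closed_nbhd S v :\ v -> y \in C.
  by move=> /setD1P[/negPf yv /setIdP[Sy]]; rewrite yv => vy; apply: (nbrB v).
have badv c : {in closed_nbhd S v :\ v, forall y, (c <= zeta y)%N} ->
    1 < weight (zeta v) + d%:R * (2 / (2 * c + 1)%:R).
  rewrite -degv => /(sum_weight_nbhd Sv); apply: lt_le_trans.
  by have := bad v v Sv Sv; rewrite cards2 eqxx -ltNge.
have := badv d.+1 (fun y yv => zC y (nbrv y yv)).
have wv : weight (zeta v) <= 2 / (2 * d + 1)%:R by apply/weight_le/zS.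
have [d0|dN0] := eqVneq d 0%N.
  by rewrite d0 mul0r addr0 ltNge weight_le1.
have [d1 _|dN1] := eqVneq d 1%N; last first.
  (* After clearing denominators, [2 / (2 * d + 1) + 2 * d / (2 * d + 3) <= 1] reads
     [3 <= 2 * d]. *)
  have d2 : 2 <= d%:R :> rat by rewrite ler_nat; lia.
  rewrite ltNge => /negP; case; apply: le_trans (lerD wv (lexx _)) _.
  rewrite -addn1 !(natrD, natrM) mulrA addf_div; last 2 first.
  - by apply: lt0r_neq0; lra.
  - by apply: lt0r_neq0; lra.
  by rewrite ler_pdivrMr; nra.
(* Now [d = 1]: [B] is the set of leaves of [S], and [C] has minimum degree at least 2. *)
pose B2 := [set x in C | deg C x == 2].
have zC2 : {in C, forall u, (2 <= zeta u)%N} by move=> u /zC; rewrite d1.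
have B2C x : x \in B2 -> x \in C by rewrite inE => /andP[].
have leaf_uniq x y y' : x \in B -> adj x y -> y \in S -> adj x y' -> y' \in S -> y = y'.
  move=> Bx xy Sy xy' Sy'; have /eqP := degB x Bx; rewrite d1 => /cards1P[u Nu].
  have : y \in [set y in S | adj x y] by rewrite inE Sy.
  have : y' \in [set y in S | adj x y] by rewrite inE Sy'.
  by rewrite Nu !inE => /eqP-> /eqP->.
(* Otherwise the pair would cost at most [2/3 + 3 * (2/5) < 2]. *)
have leaf_pair l y : l \in B -> y \in B2 ->
    ~~ (joint_nbhd l y \subset l |: closed_nbhd C y).
  move=> Bl By; apply/negP => sub.
  have Cy := B2C y By.
  have ly : l != y by apply: contraTneq Cy => <-; rewrite inE Bl.
  move/negP: (bad l y (BS l Bl) (CS y Cy)); apply.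
  rewrite cards2 ly (big_setD1 l) /=; last by rewrite !inE (BS l Bl) eqxx.
  have leD : joint_nbhd l y :\ l \subset closed_nbhd C y.
    apply/subsetP => u; rewrite in_setD1 => /andP[ul /(subsetP sub)].
    by rewrite in_setU1 (negPf ul).
  have zD : {in closed_nbhd C y, forall u, (2 <= zeta u)%N}.
    by move=> u; rewrite inE => /andP[/zC2].
  have := sum_weight_le leD zD; rewrite card_closed_nbhd //.
  have -> : deg C y = 2 by move: By; rewrite inE => /andP[_ /eqP].
  have : weight (zeta l) <= 2 / (2 * 1 + 1)%:R.
    by apply: weight_le; rewrite -d1; apply/zS/BS.
  move=> h1 h2; apply: le_trans (lerD h1 h2) _.
  by rewrite -[(2 * 1 + 1)%N]/3%N -[(2 * 2 + 1)%N]/5%N; lra.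
have nbhd_leaf l y u : l \in B -> adj l y -> y \in S -> u \in closed_nbhd S l ->
    u = l \/ u = y.
  move=> Bl ly Sy; rewrite inE => /andP[Su /orP[/eqP|lu]]; first by left.
  by right; apply: (leaf_uniq l).
have CorB u : u \in S -> (u \in B) || (u \in C).
  by move=> Su; rewrite in_setD Su andbT; case: (u \in B).
(* A second leaf at [y] would share [y] with [l], leaving only 3 vertices in their union; so [l] is
   the only leaf at [y], and [leaf_pair] applies. *)
have leaf1 y l : y \in B2 -> l \in B -> ~~ adj l y.
  move=> By Bl; apply/negP => ly; have Cy := B2C y By; have Sy := CS y Cy.
  move/negP: (leaf_pair l y Bl By); apply; apply/subsetP => u.
  rewrite inE => /orP[/(nbhd_leaf l y u Bl ly Sy) [->|->]|].
  - by rewrite !inE eqxx.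
  - by rewrite in_setU1 inE Cy eqxx orbT.
  rewrite inE => /andP[Su yu]; rewrite in_setU1 inE yu andbT.
  have /orP[Bu|->] := CorB u Su; last by rewrite orbT.
  have uNy : u != y by apply: contraTneq Cy => <-; rewrite inE Bu.
  move: yu; rewrite (negPf uNy) adj_sym /= => uy; case: (eqVneq u l) => //= uNl.
  have := farS u l Su (BS l Bl) uNl.
  have := @card_joint_nbhd _ S u l [set y] Su (BS l Bl).
  by rewrite sub1set !inE Sy uy ly !orbT cards1 !degB // d1 => /(_ isT); clear; lia.
(* By [leaf1] no leaf is adjacent to [y], and the only neighbour of [l] is [z], already in the
   closed neighbourhood of [y]. *)
have leaf2 y z l : y \in B2 -> z \in C -> adj y z -> l \in B -> ~~ adj l z.
  move=> By Cz yz Bl; apply/negP => lz.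
  move/negP: (leaf_pair l y Bl By); apply; apply/subsetP => u.
  rewrite inE => /orP[/(nbhd_leaf l z u Bl lz (CS z Cz)) [->|->]|].
  - by rewrite !inE eqxx.
  - by rewrite in_setU1 inE Cz yz !orbT.
  rewrite inE => /andP[Su yu]; rewrite in_setU1 inE yu andbT.
  have /orP[Bu|->] := CorB u Su; last by rewrite orbT.
  have uNy : u != y by apply: contraTneq (B2C y By) => <-; rewrite in_setD Bu.
  by move: yu; rewrite (negPf uNy) adj_sym (negPf (leaf1 y u By Bu)).
have nbhdC x : x \in C -> {in B, forall l, ~~ adj l x} ->
    closed_nbhd S x = closed_nbhd C x.
  move=> Cx noB; apply/setP => u; apply/setIdP/setIdP => -[Su xu]; last first.
    by split; first exact: CS.
  split=> //; have /orP[Bu|//] := CorB u Su.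
  case/orP: xu => [/eqP ux|xu]; first by move: Cx; rewrite in_setD -ux Bu.
  by move: (noB u Bu); rewrite adj_sym xu.
(* Costs are measured in [S] but degrees in [C]; [leaf1] and [leaf2] make the closed neighbourhoods
   agree for the pairs concerned. *)
have dC2 : {in C :\: B2, forall x, (3 <= deg (C :\: B2) x)%N}.
  apply: degree_core => [x /dC|x y Bx Cy xy yB2]; first by rewrite d1.
  have Cx := B2C x Bx.
  have Nx : closed_nbhd S x = closed_nbhd C x.
    by apply: nbhdC => // l Bl; apply: leaf1.
  have Ny : closed_nbhd S y = closed_nbhd C y.
    apply: nbhdC => // l Bl; case/orP: yB2 => [By|]; first exact: leaf1.
    by move=> xy'; apply: (leaf2 x).
  apply: (far _ 2 x y); rewrite ?CS // -?Nx -?Ny //.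
  by rewrite Nx Ny => u; rewrite in_setU => /orP[] /setIdP[/zC2].
have z3 : {in closed_nbhd S v :\ v, forall y, (3 <= zeta y)%N}.
  move=> y Ny; apply: (zeta_ge dC2); rewrite in_setD (nbrv y Ny) andbT.
  apply/negP => By; move/negP: (leaf1 y v By Bv); apply.
  by move: Ny; rewrite !inE => /and3P[/negPf-> _].
have := badv 3 z3; rewrite ltNge => /negP; case.
apply: le_trans (lerD wv (lexx _)) _.
by rewrite d1 -[(2 * 1 + 1)%N]/3%N -[(2 * 3 + 1)%N]/7%N; lra.
Qed.

End GreedyStep.

(** * Iterating the greedy removal *)

Lemma k_independent_weight (G : sgraph) (S : {set G}) :
  exists I : {set G},
    [/\ I \subset S, k_independent 1 I & \sum_(x in S) weight (zeta x) <= #|I|%:R].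
Proof.
(* Only [S] shrinks: [zeta] is always that of [G], so the weights do not change during the
   induction. *)
have [n] := ubnP #|S|; elim: n => // n IHn in S *; rewrite ltnS => leSn.
have [->|S0] := eqVneq S set0.
  exists set0; rewrite sub0set big_set0 ler0n; split=> //.
  by apply/bigmax_leqP => x; rewrite inE.
have [x [y [Sx Sy le_xy]]] := greedy_pair S0.
set N := closed_nbhd S x :|: closed_nbhd S y in le_xy.
have Nx : x \in N by rewrite !inE Sx eqxx.
have sNS : N \subset S by apply/subsetP => u; rewrite !inE => /orP[] /andP[].
have ltSN : (#|S :\: N| < n)%N.
  apply: leq_trans leSn; apply: proper_card; apply/properP.
  by split; [exact: subsetDl | exists x; rewrite // inE Nx].
have [J [sJ indJ leJ]] := IHn _ ltSN.
have sJS := subset_trans sJ (subsetDl S N).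
exists ([set x; y] :|: J); split.
- by rewrite !subUset !sub1set Sx Sy.
- apply: k_independent_setU => //; first exact: k_independent_pair.
  move=> a b; rewrite !inE => Aa Jb.
  have /setDP[Sb] := subsetP sJ b Jb; apply: contraNN => ab.
  by rewrite !inE Sb /=; case/orP: Aa => /eqP <-; rewrite ab !orbT.
- have xyJ0 : [set x; y] :&: J = set0.
    apply/setP => u; rewrite in_set0; apply/negP.
    move=> /setIP[/set2P uxy /(subsetP sJ) /setDP[_ /negP]]; apply.
    by case: uxy => ->; rewrite !inE ?Sx ?Sy eqxx ?orbT.
  rewrite cardsU xyJ0 cards0 subn0 natrD (big_setID N) (setIidPr sNS) /=.
  exact: lerD.
Qed.

Unset Implicit Arguments.

Theorem theorem5 (G : sgraph) (hG : (0 < #|G|)%N) : (alpha G 1)%:R >= Z2 G.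
Proof.
have [I [_ indI leI]] := @k_independent_weight G setT.
apply: (@le_trans _ _ #|I|%:R); last first.
  by rewrite ler_nat; apply: (leq_bigmax_cond I).
by move: leI; rewrite /Z2 (eq_bigl predT) // => x; rewrite inE.
Qed.
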